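(* For every $x\in[0,L]$, $$\lim_{n\to\infty}H_n(x)=F(x).$$
   Context: $a(t)=t^{-1}+t^2$, and $T_n(a)$ is the $n\times n$ Toeplitz matrix whose $(j,k)$ entry is $1$ if $k=j+1$ or $k=j-2$, and $0$ otherwise. $L=3/\sqrt[3]{4}$. For $n\ge 3$ put $m=\lfloor n/3\rfloor$. The matrix $T_n(a)$ has exactly $m$ eigenvalues in $(0,L)$, all simple, and no other strictly positive eigenvalues; they are denoted $0<\lambda_{n,1}<\dots<\lambda_{n,m}<L$. Define $H_n\colon\mathbb{R}\to[0,1]$ by $$H_n(x)=\frac{\#\{j\in\{1,\dots,m\}:\ \lambda_{n,j}\le x\}}{n}$$ (note the division by $n$, not $m$). Define $F\colon[0,L]\to[0,1/3]$ by $F(0)=0$ and, for $0<\lambda\le L$, $$F(\lambda)=\frac13-\frac1\pi\arctan\left(\sqrt3\,\tanh\left(\tfrac13\operatorname{arcosh}\big((L/\lambda)^{3/2}\big)\right)\right),$$ where $\operatorname{arcosh}\colon[1,\infty)\to[0,\infty)$ is the inverse of $\cosh$. *)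

(* Defs.v *)
From mathcomp Require Import all_boot all_order all_algebra finmap.
From mathcomp Require Import all_classical all_reals all_analysis.
From mathcomp Require Import ring.
Set Implicit Arguments.
Unset Strict Implicit.
Unset Printing Implicit Defensive.
Import Order.TTheory GRing.Theory Num.Theory.
Import numFieldNormedType.Exports.
Local Open Scope classical_set_scope.
Local Open Scope ring_scope.

Section Hyperbolic.
Variable R : realType.
Implicit Types t y : R.

Definition cosh t : R := (expR t + expR (- t)) / 2.
Definition sinh t : R := (expR t - expR (- t)) / 2.
Definition tanh t : R := sinh t / cosh t.

(* The inverse of cosh : [0, +oo[ -> [1, +oo[; meaningful only for 1 <= y. *)
Definition arcosh y : R := get [set t | 0 <= t /\ cosh t = y].

Lemma cosh_ge0_inj : {in `[0, +oo[ &, injective cosh}.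
Proof.
suff H s t : 0 <= s -> s < t -> cosh s < cosh t.
  move=> s t; rewrite !in_itv/= !andbT => s0 t0 st.
  by case: (ltgtP s t) => // [/(H _ _ s0)|/(H _ _ t0)]; rewrite st ltxx.
move=> s0 st; rewrite /cosh ltr_pM2r ?invr_gt0 ?ltr0n// -subr_gt0.
have es : 1 <= expR s by rewrite -expR0 ler_expR.
have et : expR s < expR t by rewrite ltr_expR.
have s_gt0 := expR_gt0 s; have t_gt0 := expR_gt0 t.
rewrite !expRN.
have -> : expR t + (expR t)^-1 - (expR s + (expR s)^-1) =
    (expR t - expR s) * (1 - (expR s * expR t)^-1).
  by field; rewrite !gt_eqF.
rewrite mulr_gt0 ?subr_gt0// invf_lt1 ?mulr_gt0//.
apply: (le_lt_trans es); apply: (lt_le_trans et).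
by rewrite ler_peMl// ltW.
Qed.

Lemma arcoshP y : 1 <= y -> 0 <= arcosh y /\ cosh (arcosh y) = y.
Proof.
move=> y1; rewrite /arcosh.
suff [t ty] : exists t, [set t | 0 <= t /\ cosh t = y] t by exact: (getI ty).
have y0 : 0 <= y by rewrite (le_trans _ y1).
have s0 : 0 <= y ^+ 2 - 1 by rewrite subr_ge0 exprn_ege1.
set s := Num.sqrt (y ^+ 2 - 1).
have ys1 : 1 <= y + s by rewrite (le_trans y1)// lerDl sqrtr_ge0.
have ys0 : 0 < y + s by rewrite (lt_le_trans _ ys1).
exists (ln (y + s)); split; first exact: ln_ge0.
rewrite /cosh expRN lnK ?posrE//.
have -> : (y + s)^-1 = y - s.
  apply: (mulfI (lt0r_neq0 ys0)); rewrite mulfV ?lt0r_neq0//.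
  by rewrite mulrC -subr_sqr sqr_sqrtr// opprB addrC subrK.
by rewrite addrACA subrr addr0 -mulr2n -[y *+ 2]mulr_natr mulfK// pnatr_eq0.
Qed.

Lemma coshK t : 0 <= t -> arcosh (cosh t) = t.
Proof.
move=> t0; have [a0 ca] : [set u | 0 <= u /\ cosh u = cosh t] (arcosh (cosh t)).
  exact: (@getI _ _ t).
by apply: cosh_ge0_inj; rewrite // in_itv/= andbT.
Qed.

End Hyperbolic.

Section Spectrum.
Variable R : realType.

(* T_n(a) for a(t) = t^-1 + t^2, with 0-based indices. *)
Definition toeplitz (n : nat) : 'M[R]_n :=
  \matrix_(j < n, k < n) ((k == j.+1 :> nat) || (j == k.+2 :> nat))%:R.

Definition L : R := 3 / (4 `^ (3^-1)).

Definition spectrum0L (n : nat) : set R :=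
  [set l | eigenvalue (toeplitz n) l /\ 0 < l < L].

Lemma finite_spectrum0L (n : nat) : finite_set (spectrum0L n).
Proof.
apply: contrapT => /(infinite_set_fset (size (char_poly (toeplitz n)))).
move=> [B BA]; apply/negP; rewrite -ltnNge.
apply: max_poly_roots; rewrite ?fset_uniq ?monic_neq0 ?char_poly_monic//.
by apply/allP => x /BA[]; rewrite eigenvalue_root_char.
Qed.

(* The eigenvalues in ]0, L[ in increasing order. *)
Definition eigs (n : nat) : seq R := sort <=%R (fset_set (spectrum0L n)).

(* 0-based: lambda n j stands for lambda_{n,j+1}. As eigs n has exactly n %/ 3
   elements for n >= 3, the default value of nth is never used for j < n %/ 3. *)
Definition lambda (n j : nat) : R := nth 0 (eigs n) j.

Definition H (n : nat) (x : R) : R :=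
  #|[set j : 'I_(n %/ 3) | lambda n j <= x]%SET|%:R / n%:R.

(* Meaningful only for 0 <= l <= L. *)
Definition F (l : R) : R :=
  if l == 0 then 0 else
  1 / 3 - 1 / pi *
    atan (Num.sqrt 3 * tanh (1 / 3 * arcosh ((L / l) `^ (3 / 2)))).

Lemma mem_eigs (n : nat) (l : R) :
  (l \in eigs n) <-> eigenvalue (toeplitz n) l /\ 0 < l < L.
Proof.
rewrite /eigs mem_sort in_fset_set; last exact: finite_spectrum0L.
by rewrite inE.
Qed.

Lemma eigs_sorted (n : nat) : sorted <%R (eigs n).
Proof.
by rewrite lt_sorted_uniq_le sort_uniq fset_uniq sort_sorted//; exact: le_total.
Qed.

End Spectrum.

(* Main.v *)
(* Expanding an eigenvector of T_n(a) backwards from its last entry shows that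
   the characteristic polynomials satisfy D_(n+1) = l D_n - D_(n-2), so that
   D_n(l) = l^(n mod 3) Q(l^3) with deg Q = n/3, and D_n has at most n/3
   positive roots.  Each l in ]0, L[ is l(t) for one t in ]0, pi/3[, where
   z^3 - l z^2 + 1 has the roots r exp(+- i t) and -1/r^2, with
   r^3 = 2 cos t > 1.  As r dominates, the points t_k = (k + 1/2) pi / (n + 2)
   satisfy sgn D_n(l(t_k)) = (-1)^k, so D_n has a root between l(t_(k+1)) and
   l(t_k).  This accounts for all but O(1) of the possible roots, and since
   l(t) is decreasing, #{l <= l(t)} = n (1/3 - t/pi) + O(1).  Finally
   l(t)^3 = (4 cos^2 t - 1)^3 / (4 cos^2 t), and cosh(3u) = 4 cosh^3 u - 3 cosh u
   identifies t with the arctangent in F. *)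
Require Import Defs.
From mathcomp Require Import all_boot all_order all_algebra finmap.
From mathcomp Require Import all_classical all_reals all_analysis.
From mathcomp Require Import ring lra zify.
Import Order.TTheory GRing.Theory Num.Theory.
Import numFieldNormedType.Exports.
Local Open Scope classical_set_scope.
Local Open Scope ring_scope.

(** * Characteristic polynomials and their recurrence *)

(* The two leading zeros make the three-term recurrence hold from the start:
   [dpoly n.+2] is the characteristic polynomial of [toeplitz R n]. *)
Fixpoint dpoly {R : realType} (n : nat) : {poly R} :=
  match n with
  | 0 | 1 => 0
  | 2 => 1
  | ((k.+1).+1 as p).+1 => 'X * dpoly p - dpoly k
  end.

Lemma dpolyS3 {R : realType} n :
  dpoly n.+3 = 'X * dpoly n.+2 - dpoly n :> {poly R}.
Proof. by []. Qed.

(** Two zero initial values leave [f 2] as the only free parameter. The recurrence is asked only for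
    [i < n], since an eigenvector supplies just [n] equations. *)
Lemma recurrence_dpoly {R : realType} (n : nat) (f : nat -> R) (l : R) :
  f 0 = 0 -> f 1 = 0 ->
  (forall i, (i < n)%N -> f i.+3 = l * f i.+2 - f i) ->
  forall i, (i <= n.+2)%N -> f i = f 2 * (dpoly i).[l].
Proof.
move=> f0 f1 frec i.
elim/ltn_ind: i => -[|[|[|i]]] IH ilt.
- by rewrite f0 horner0 mulr0.
- by rewrite f1 horner0 mulr0.
- by rewrite hornerC mulr1.
rewrite dpolyS3 !hornerE frec// (IH i.+2)// ?(IH i); [ring|lia..].
Qed.

Lemma mul_row_toeplitz {R : realType} (n : nat) (u : nat -> R) (k : 'I_n) :
  ((\row_(j < n) u j) *m toeplitz R n) 0 k =
  (if (0 < k)%N then u k.-1 else 0) + (if (k.+2 < n)%N then u k.+2 else 0).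
Proof.
rewrite mxE (eq_bigr (fun j : 'I_n =>
  (if j.+1 == k :> nat then u j else 0) +
  (if j == k.+2 :> nat then u j else 0))); last first.
  move=> j _; rewrite !mxE eq_sym mulr_natr mulrb.
  by case: eqP => [|_]; case: eqP => /=; rewrite ?addr0 ?add0r//; lia.
rewrite big_split/= -!big_mkcond/= (big_ord1_eq _ (fun i => u i)).
congr (_ + _); case: k => -[|k] kn /=; first by rewrite big1.
rewrite (eq_bigl (fun j : 'I_n => j == k :> nat))//.
by rewrite (big_ord1_eq _ (fun i => u i)) ltnW.
Qed.

(** An eigenvector read backwards, preceded by two zeros, obeys the recurrence of [dpoly]; the zero
    that follows its first entry says that [l] is a root. *)
Lemma eigenvalue_dpoly {R : realType} (n : nat) (l : R) :
  eigenvalue (toeplitz R n) l = root (dpoly n.+2) l.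
Proof.
(* Eigenvectors are row vectors; equation [i] is that of column [n.-1 - i]. *)
have eqE (u : nat -> R) : \row_(j < n) u j *m toeplitz R n =
    l *: \row_(j < n) u j <->
    (forall i, (i < n)%N ->
      (if (i.+1 < n)%N then u (n - i.+2)%N else 0) +
      (if (1 < i)%N then u (n.+1 - i)%N else 0) = l * u (n.-1 - i)%N).
  have kE i : (i < n)%N -> ((n.-1 - i).-1 = n - i.+2)%N by lia.
  have kE2 i : (1 < i)%N -> (i < n)%N -> ((n.-1 - i).+2 = n.+1 - i)%N by lia.
  have c1 i : (i < n)%N -> (0 < n.-1 - i)%N = (i.+1 < n)%N by lia.
  have c2 i : (i < n)%N -> ((n.-1 - i).+2 < n)%N = (1 < i)%N by lia.
  split=> [uE i ilt|uE].
    have klt : (n.-1 - i < n)%N by lia.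
    move/matrixP/(_ 0 (Ordinal klt)): uE.
    rewrite mul_row_toeplitz !mxE/= => <-.
    by rewrite kE// c1// c2//; case: ifP => // i1; case: ifP => // ?; rewrite kE2.
  apply/matrixP => o k; rewrite (ord1 o) mul_row_toeplitz !mxE.
  have ilt : (n.-1 - k < n)%N by case: k => /=; lia.
  have kk : (n.-1 - (n.-1 - k) = k)%N by case: k ilt => /=; lia.
  have := uE _ ilt; rewrite kk => <-.
  rewrite -(kE _ ilt) -(c1 _ ilt) -(c2 _ ilt) !kk.
  congr (_ + _); case: ifP => // k2; congr (u _).
  by case: k k2 {kk ilt} => /= k; lia.
apply/eigenvalueP/rootP => [[v vE v0]|dl].
  pose u j := if insub j is Some i then v 0 i else 0.
  have uv : \row_(j < n) u j = v.
    by apply/rowP => j; rewrite mxE /u valK.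
  rewrite -uv in vE v0; move/eqE: vE => uE.
  (* The zeros of [g] at 0, 1 and [n.+2] stand for the terms missing at the borders of the
     matrix. *)
  pose g i := if (1 < i < n.+2)%N then u (n.+1 - i)%N else 0.
  have gE := @recurrence_dpoly R n g l.
  have {}gE i : (i <= n.+2)%N -> g i = g 2%N * (dpoly i).[l].
    apply: gE => // j jn.
    have := uE j jn.
    have -> : (n - j.+2 = n.+1 - j.+3)%N by lia.
    have -> : (n.-1 - j = n.+1 - j.+2)%N by lia.
    rewrite /g (_ : (j.+3 < n.+2)%N = (j.+1 < n)%N)//.
    rewrite (_ : (j.+2 < n.+2)%N = true)// (_ : (j < n.+2)%N = true); last lia.
    by rewrite andbT /= => <-; rewrite andbT addrK.
  have /esym/eqP := gE n.+2 (leqnn _).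
  (* If [g 2] is 0, then so is all of [g], hence [v]. *)
  rewrite {2}/g ltnn andbF mulf_eq0 => /orP[/eqP g2|/eqP//].
  case/eqP: v0; apply/rowP => j; rewrite !mxE.
  have := gE (n.+1 - j)%N.
  rewrite g2 mul0r /g.
  have -> : (1 < n.+1 - j < n.+2)%N by case: j => /=; lia.
  have -> : (n.+1 - (n.+1 - j) = j)%N by case: j => /=; lia.
  by apply; case: j => /=; lia.
have n0 : (0 < n)%N.
  by case: n eqE dl => // _ /eqP; rewrite hornerC oner_eq0.
exists (\row_(j < n) (dpoly (n.+1 - j)).[l]).
  apply/(eqE (fun j => (dpoly (n.+1 - j)).[l])) => i ilt.
  have -> : (n.+1 - (n.-1 - i) = i.+2)%N by lia.
  have -> : (if (i.+1 < n)%N then (dpoly (n.+1 - (n - i.+2))).[l] else 0) =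
            (dpoly i.+3).[l].
    case: ifP => i1; first by congr ((dpoly _).[l]); lia.
    by rewrite -dl; congr ((dpoly _).[l]); lia.
  have -> : (if (1 < i)%N then (dpoly (n.+1 - (n.+1 - i))).[l] else 0) =
            (dpoly i).[l].
    case: ifP => i1; first by congr ((dpoly _).[l]); lia.
    by case: i {ilt} i1 => [|[|]]//; rewrite horner0.
  by rewrite dpolyS3 !hornerE subrK.
(* The last entry of the witness is [dpoly 2], that is 1. *)
apply/eqP => /rowP; case: n n0 {eqE dl} => // n _ /(_ ord_max).
rewrite !mxE/= subSn ?leqnSn// subSnn hornerC => /eqP.
by rewrite oner_eq0.
Qed.

(** * Dependence on the cube of the variable, and the number of positive roots *)

(** The recurrence moves between residues modulo 3, so the induction carries three consecutive
    polynomials. Only the return to residue 0 raises the degree of the factor [Q]. *)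
Lemma dpoly_cube {R : realType} (m r : nat) : (r < 3)%N ->
  exists2 Q : {poly R}, size Q = m.+1 &
    dpoly (3 * m + r).+2 = 'X^r * (Q \Po 'X^3).
Proof.
suff [Q0 [Q1 [Q2 [[s0 s1 s2] [e0 e1 e2]]]]] : exists Q0 Q1 Q2 : {poly R},
    [/\ size Q0 = m.+1, size Q1 = m.+1 & size Q2 = m.+1] /\
    [/\ dpoly (3 * m).+2 = Q0 \Po 'X^3,
        dpoly (3 * m).+3 = 'X * (Q1 \Po 'X^3) &
        dpoly (3 * m).+4 = 'X^2 * (Q2 \Po 'X^3)].
  case: r => [|[|[|//]]] _.
  - by exists Q0; rewrite // addn0 expr0 mul1r.
  - by exists Q1; rewrite // addn1 expr1.
  - by exists Q2; rewrite // addn2.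
elim: m => [|m [Q0 [Q1 [Q2 [[s0 s1 s2] [e0 e1 e2]]]]]].
  exists 1, 1, 1; rewrite size_poly1; split => //; rewrite muln0 !comp_polyC.
  by rewrite polyC1 !dpolyS3/= !subr0 !mulr1 expr2.
pose P0 := 'X * Q2 - Q0; pose P1 := P0 - Q1; pose P2 := P1 - Q2.
have t0 : size P0 = m.+2.
  have sX : size ('X * Q2) = m.+2.
    by rewrite mulrC size_mulX ?s2// -size_poly_eq0 s2.
  by rewrite size_polyDl ?sX// size_polyN s0.
have t1 : size P1 = m.+2 by rewrite size_polyDl ?t0// size_polyN s1.
have t2 : size P2 = m.+2 by rewrite size_polyDl ?t1// size_polyN s2.
have -> : (3 * m.+1 = (3 * m).+3)%N by lia.
have f0 : dpoly (3 * m).+3.+2 = P0 \Po 'X^3 :> {poly R}.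
  by rewrite dpolyS3 e2 e0 /P0 comp_polyB comp_polyM comp_polyX; ring.
have f1 : dpoly (3 * m).+3.+3 = 'X * (P1 \Po 'X^3) :> {poly R}.
  by rewrite dpolyS3 f0 e1 [P1 \Po _]comp_polyB mulrBr.
exists P0, P1, P2; split; split => //.
by rewrite dpolyS3 f1 e2 [P2 \Po _]comp_polyB; ring.
Qed.

(** Cubing is injective on positive reals and maps the eigenvalues to roots of [Q], of degree
    [n %/ 3]. *)
Lemma size_eigs {R : realType} (n : nat) : (size (eigs R n) <= n %/ 3)%N.
Proof.
have [Q sQ dQ] := @dpoly_cube R (n %/ 3) (n %% 3) (@ltn_pmod n 3 isT).
have eigsP l : l \in eigs R n -> 0 < l /\ root Q (l ^+ 3).
  move/mem_eigs => [el /andP[l0 _]]; split=> //; move: el.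
  have -> : n = (3 * (n %/ 3) + n %% 3)%N by rewrite mulnC -divn_eq.
  rewrite eigenvalue_dpoly dQ rootM -[_ (_ \Po _) l]/(_ == 0) horner_comp hornerXn.
  by rewrite -[root ('X^_) l]/(_ == 0) hornerXn expf_eq0 gt_eqF// andbF.
rewrite -ltnS -sQ -(size_map (fun l => l ^+ 3)).
apply: max_poly_roots; first by rewrite -size_poly_eq0 sQ.
  by apply/allP => _ /mapP[l /eigsP[_ ?] ->].
rewrite map_inj_in_uniq; first by rewrite sort_uniq fset_uniq.
move=> a b /eigsP[a0 _] /eigsP[b0 _] /eqP.
by rewrite eqrXn2 ?ltW// => /eqP.
Qed.

(** * Trigonometric closed form and its sign *)

Definition radius {R : realType} (t : R) : R := (2 * cos t) `^ (3^-1).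

(* For [0 < cos t], the roots of [z^3 - l z^2 + 1] with [l := symb t] are
   [radius t * exp (+- i t)] and [- (radius t)^-2]. *)
Definition symb {R : realType} (t : R) : R := radius t ^+ 4 - radius t ^- 2.

Lemma radius_gt0 {R : realType} (t : R) : 0 < cos t -> 0 < radius t.
Proof. by move=> c0; rewrite powR_gt0// mulr_gt0. Qed.

Lemma radiusX3 {R : realType} (t : R) : 0 < cos t -> radius t ^+ 3 = 2 * cos t.
Proof.
move=> c0; have c2 : 0 <= 2 * cos t by rewrite mulr_ge0// ltW.
rewrite -powR_mulrn ?powR_ge0// -powRrM mulVf ?powRr1//.
Qed.

(** With z = r e^(it), the right-hand side is Im(z^n conj(z - s)) + s^n Im z, a combination of
    powers of the three roots that vanishes for n = 0, 1. The factor on the left is its value at n =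
    2, namely Im z |z - s|^2. *)
Lemma horner_dpoly_symb {R : realType} (t : R) (n : nat) : 0 < cos t ->
  let r := radius t in let s := - r ^- 2 in
  r * sin t * (r ^+ 2 - 2 * r * s * cos t + s ^+ 2) * (dpoly n).[symb t] =
  r ^+ n * (sin (n%:R * t) * (r * cos t - s) - cos (n%:R * t) * (r * sin t)) +
  s ^+ n * (r * sin t).
Proof.
move=> c0 r s.
have r0 : 0 < r by exact: radius_gt0.
have r3 : r ^+ 3 = 2 * cos t by exact: radiusX3.
(* Product and sum of the three roots. *)
have sr : s * r ^+ 2 = -1 by rewrite /s mulNr mulVf// gt_eqF// exprn_gt0.
have lE : symb t = 2 * r * cos t + s by rewrite /symb -/r -/s exprS r3; ring.
have cs := cos2Dsin2 t.
set l := symb t in lE *.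
pose C k := cos (k%:R * t); pose S k := sin (k%:R * t).
have C2 : cos (2 * t) = 2 * cos t ^+ 2 - 1.
  by rewrite mulr_natl cos_mulr2n; ring.
have S2 : sin (2 * t) = 2 * sin t * cos t.
  by rewrite mulr_natl sin_mulr2n; ring.
have C3 : cos (3 * t) = cos t * (2 * cos t ^+ 2 - 1) - 2 * sin t ^+ 2 * cos t.
  have -> : 3 * t = t + 2 * t by ring.
  by rewrite cosD C2 S2; ring.
have S3 : sin (3 * t) = sin t * (2 * cos t ^+ 2 - 1) + 2 * sin t * cos t ^+ 2.
  have -> : 3 * t = t + 2 * t by ring.
  by rewrite sinD C2 S2; ring.
(* [eC] and [eS] are the real and imaginary parts of z^3 = l z^2 - 1; [es] is the same equation at
   [s]. *)
have eC : r ^+ 3 * cos (3 * t) = l * (r ^+ 2 * cos (2 * t)) - 1.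
  have -> : l * (r ^+ 2 * cos (2 * t)) - 1 =
      2 * r ^+ 3 * cos t * cos (2 * t) + s * r ^+ 2 * cos (2 * t) - 1.
    by rewrite lE; ring.
  by rewrite sr r3 C3 C2 sin2cos2; ring.
have eS : r ^+ 3 * sin (3 * t) = l * (r ^+ 2 * sin (2 * t)).
  have -> : l * (r ^+ 2 * sin (2 * t)) =
      2 * r ^+ 3 * cos t * sin (2 * t) + s * r ^+ 2 * sin (2 * t).
    by rewrite lE; ring.
  by rewrite sr r3 S3 S2; ring.
have es : s ^+ 3 = l * s ^+ 2 - 1.
  have <- : 2 * cos t * r * s ^+ 2 = 1.
    by transitivity ((s * r ^+ 2) ^+ 2); [rewrite -r3; ring|rewrite sr; ring].
  by rewrite lE; ring.
pose f k := r ^+ k * (S k * (r * cos t - s) - C k * (r * sin t)) +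
  s ^+ k * (r * sin t).
have SD k j : S (k + j)%N = S k * C j + C k * S j.
  by rewrite /S natrD mulrDl sinD.
have CD k j : C (k + j)%N = C k * C j - S k * S j.
  by rewrite /C natrD mulrDl cosD.
have [S0 C0] : S 0%N = 0 /\ C 0%N = 1 by rewrite /S /C mul0r sin0 cos0.
have [S1 C1] : S 1%N = sin t /\ C 1%N = cos t by rewrite /S /C mul1r.
have f0 : f 0%N = 0 by rewrite /f S0 C0; ring.
have f1 : f 1%N = 0 by rewrite /f S1 C1; ring.
have frec i : f i.+3 = l * f i.+2 - f i.
  rewrite /f -(addn3 i) -(addn2 i) !SD !CD !exprD.
  rewrite -[C 3]/(cos (3 * t)) -[C 2]/(cos (2 * t)).
  rewrite -[S 3]/(sin (3 * t)) -[S 2]/(sin (2 * t)).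
  apply/eqP; rewrite -subr_eq0; apply/eqP.
  (* The defect of the recurrence is a combination of the defects of [eC], [eS] and [es]. *)
  transitivity (r ^+ i * (S i * (r * cos t - s) - C i * (r * sin t)) *
     (r ^+ 3 * cos (3 * t) - (l * (r ^+ 2 * cos (2 * t)) - 1)) +
     r ^+ i * (C i * (r * cos t - s) + S i * (r * sin t)) *
     (r ^+ 3 * sin (3 * t) - l * (r ^+ 2 * sin (2 * t))) +
     s ^+ i * (r * sin t) * (s ^+ 3 - (l * s ^+ 2 - 1))); first by ring.
  by rewrite eC eS es !subrr; ring.
have := @recurrence_dpoly R n f l f0 f1 (fun i _ => frec i) n.
rewrite -/(f n) => ->; last lia.
congr (_ * _); rewrite /f -[C _]/(cos (2 * t)) -[S _]/(sin (2 * t)) C2 S2.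
have -> : 2 * cos t ^+ 2 - 1 = cos t ^+ 2 - sin t ^+ 2.
  by rewrite sin2cos2; ring.
transitivity (r * sin t *
  (r ^+ 2 * (cos t ^+ 2 + sin t ^+ 2) - 2 * r * s * cos t + s ^+ 2)).
  by rewrite cs mulr1.
by ring.
Qed.

(** The triple angle formula gives 4 c^3 - 3 c + 1 = (c + 1) (2 c - 1)^2 = 0. *)
Lemma cos_pi_third {R : realType} : cos (pi / 3 : R) = 1 / 2.
Proof.
set c := cos _.
have c0 : 0 < c.
  by rewrite cos_gt0_pihalf//; have := @pi_gt0 R; lra.
have : (c + 1) * (2 * c - 1) ^+ 2 = 0.
  have := @cospi R; have -> : pi = pi / 3 + pi / 3 *+ 2 :> R by field.
  rewrite cosD cos_mulr2n sin_mulr2n -/c => e.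
  have {}e : c * (c ^+ 2 *+ 2 - 1) - sin (pi / 3) ^+ 2 * c *+ 2 = -1.
    by rewrite -[RHS]e; ring.
  rewrite sin2cos2 -/c in e.
  transitivity (c * (c ^+ 2 *+ 2 - 1) - (1 - c ^+ 2) * c *+ 2 + 1); first ring.
  by rewrite e addNr.
move/eqP; rewrite mulf_eq0 gt_eqF ?addr_gt0// expf_eq0/= => /eqP.
by lra.
Qed.

Lemma cos_gt_half {R : realType} (t : R) : 0 <= t < pi / 3 -> 1 / 2 < cos t.
Proof.
move=> /andP[t0 t3]; rewrite -cos_pi_third ltr_cos ?in_itv//=;
  have := @pi_gt0 R; lra.
Qed.

(** Here the cosine of [n%:R * t] is 0 and its sine (-1)^k, so the closed form is (-1)^k r^n (r cos
    t - s) + s^n r sin t. The first term dominates, as r > 1 > |s| and r cos t - s > r sin t. *)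
Lemma dpoly_sign {R : realType} (t : R) (n k : nat) : 0 < t < pi / 3 ->
  n%:R * t = (k%:R + 1 / 2) * pi -> 0 < (-1) ^+ k * (dpoly n).[symb t].
Proof.
move=> /andP[t0 t3] nt.
have c2 : 1 / 2 < cos t by apply: cos_gt_half; rewrite (ltW t0).
have c0 : 0 < cos t by lra.
have s0 : 0 < sin t by apply: sin_gt0_pi; have := @pi_gt0 R; lra.
have [sS cS] : sin (n%:R * t) = (-1) ^+ k /\ cos (n%:R * t) = 0.
  rewrite nt; elim: k {nt} => [|k [IHs IHc]].
    by rewrite add0r mul1r mulrC sin_pihalf cos_pihalf.
  have -> : (k.+1%:R + 1 / 2) * pi = (k%:R + 1 / 2) * pi + pi :> R.
    by rewrite -natr1; ring.
  by rewrite sinDpi cosDpi IHs IHc exprS mulN1r oppr0.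
have := horner_dpoly_symb t n c0; rewrite sS cS /=.
set r := radius t; set s := - r ^- 2; set d := (dpoly n).[_].
have r0 : 0 < r by exact: radius_gt0.
have r3 : r ^+ 3 = 2 * cos t by exact: radiusX3.
have r1 : 1 < r.
  by rewrite -(@ltr_pXn2r _ 3) ?nnegrE ?ltW// expr1n r3; lra.
have sr : s = - r / (2 * cos t).
  by rewrite -r3 /s; field; rewrite gt_eqF.
have ns0 : s < 0 by rewrite /s oppr_lt0 invr_gt0 exprn_gt0.
have sN1 : -1 < s by rewrite /s ltrN2 invf_lt1 ?exprn_gt0// exprn_egt1.
set K := (_ + _ + _) => E.
have K0 : 0 < K.
  rewrite /K; have := mulr_gt0 r0 c0; have := exprn_gt0 2 r0.
  by have := sqr_ge0 s; nra.
have rsK : 0 < r * sin t * K by rewrite !mulr_gt0.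
rewrite -(pmulr_rgt0 _ rsK).
have -> : r * sin t * K * ((-1) ^+ k * d) =
    r ^+ n * (r * cos t - s) + ((-1) ^+ k * s ^+ n) * (r * sin t).
  have sg : (-1) ^+ k * (-1) ^+ k = 1 :> R by rewrite -expr2 sqrr_sign.
  transitivity ((-1) ^+ k * (r * sin t * K * d)); first by ring.
  rewrite E; transitivity (r ^+ n * (r * cos t - s) * ((-1) ^+ k * (-1) ^+ k) +
    (-1) ^+ k * s ^+ n * (r * sin t)); first by ring.
  by rewrite sg mulr1.
have rn1 : 1 <= r ^+ n by rewrite exprn_ege1// ltW.
have sn : `|(-1) ^+ k * s ^+ n| <= 1.
  rewrite normrM normrX normrN1 expr1n mul1r normrX exprn_ile1//.
  by rewrite ltr0_norm//; lra.
(* Divided by [r], this is sin t < cos t + 1 / (2 cos t), and the right side exceeds 1. *)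
have dom : r * sin t < r * cos t - s.
  rewrite sr mulNr opprK -mulrDr ltr_pM2l//.
  apply: (le_lt_trans (sin_le1 _)).
  rewrite -subr_gt0 (_ : _ - 1 =
    ((1 - cos t) ^+ 2 + cos t ^+ 2) / (2 * cos t)); last first.
    by field; rewrite gt_eqF.
  by rewrite divr_gt0 ?mulr_gt0// ltr_wpDl ?sqr_ge0// exprn_gt0.
have rs0 : 0 < r * sin t by exact: mulr_gt0.
move: sn; rewrite ler_norml => /andP[sn _].
set X := (-1) ^+ k * _ in sn *.
have : r * cos t - s <= r ^+ n * (r * cos t - s).
  by rewrite ler_peMl//; lra.
have : - (r * sin t) <= X * (r * sin t) by nra.
by lra.
Qed.

(** * Monotonicity and end values of [symb] *)

(** As [t] grows, the cosine and with it [radius] decrease, while r^4 - r^-2 increases with r. *)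
Lemma symb_decr {R : realType} (t u : R) :
  0 <= t -> t < u -> u <= pi / 3 -> symb u < symb t.
Proof.
move=> t0 tu u3; have pi0 := @pi_gt0 R.
have cu0 : 0 < cos u by apply: cos_gt0_pihalf; lra.
have cut : cos u < cos t by rewrite ltr_cos ?in_itv//=; lra.
have ct0 : 0 < cos t by exact: lt_trans cut.
have ru := radius_gt0 _ cu0; have rt := radius_gt0 _ ct0.
have rut : radius u < radius t.
  by rewrite -(@ltr_pXn2r _ 3) ?nnegrE ?ltW// !radiusX3// ltr_pM2l.
rewrite /symb ltrB// ?ltr_pXn2r ?nnegrE ?ltW//.
by rewrite ltf_pV2 ?posrE ?exprn_gt0// ltr_pXn2r ?nnegrE ?ltW.
Qed.

Lemma symb_pi_third {R : realType} : symb (pi / 3 : R) = 0.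
Proof.
by rewrite /symb /radius cos_pi_third mulrC divfK ?pnatr_eq0// powR1 !expr1n;
   lra.
Qed.

(** Cubing removes the cube root: [symb t] is (r^6 - 1) / r^2 with r^6 = 4 cos^2 t. *)
Lemma symbX3 {R : realType} (t : R) : 0 < cos t ->
  symb t ^+ 3 = (4 * cos t ^+ 2 - 1) ^+ 3 / (4 * cos t ^+ 2).
Proof.
move=> c0; have r0 := radius_gt0 _ c0; have r3 := radiusX3 _ c0.
have -> : 4 * cos t ^+ 2 = radius t ^+ 6.
  by rewrite (exprM _ 3 2) r3; ring.
by rewrite /symb; field; rewrite gt_eqF.
Qed.

Lemma L_gt0 {R : realType} : 0 < L R.
Proof. by rewrite divr_gt0// powR_gt0. Qed.

Lemma LX3 {R : realType} : L R ^+ 3 = 27 / 4.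
Proof.
have e : (4 `^ 3^-1) ^+ 3 = 4 :> R.
  by rewrite -powR_mulrn ?powR_ge0// -powRrM mulVf// powRr1.
by rewrite /L expr_div_n e; ring.
Qed.

Lemma symb0 {R : realType} : symb 0 = L R.
Proof.
have s0 : 0 < symb 0 :> R.
  by rewrite -[ltLHS](@symb_pi_third R) symb_decr//; have := @pi_gt0 R; lra.
apply/eqP; rewrite -(@eqrXn2 _ 3) ?(ltW s0) ?ltW ?L_gt0//.
by rewrite LX3 symbX3 cos0 //; apply/eqP; field.
Qed.

(** * The arctangent in [F] *)

(** The arctangent in [F], which turns out to invert [symb] on []0, L]]. *)
Definition angle {R : realType} (x : R) : R :=
  atan (Num.sqrt 3 * tanh (1 / 3 * arcosh ((L R / x) `^ (3 / 2)))).

Lemma cosh2Bsinh2 {R : realType} (u : R) : cosh u ^+ 2 - sinh u ^+ 2 = 1.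
Proof. by rewrite /cosh /sinh expRN; field; rewrite gt_eqF// expR_gt0. Qed.

Lemma cosh_gt0 {R : realType} (u : R) : 0 < cosh u.
Proof. by rewrite divr_gt0// addr_gt0// expR_gt0. Qed.

Lemma cosh_triple {R : realType} (u : R) :
  cosh (3 * u) = 4 * cosh u ^+ 3 - 3 * cosh u.
Proof.
rewrite /cosh !expRN expRM_natl.
by field; rewrite gt_eqF// expR_gt0.
Qed.

(** With C = cosh u, tripling gives y = C (4 C^2 - 3), and z^2 = 3 (C^2 - 1) / C^2 gives cos^2 (atan
    z) = C^2 / (4 C^2 - 3). Then [symbX3] yields 27 / (4 y^2) = x^3. *)
Lemma angle_symb {R : realType} (x : R) : 0 < x <= L R ->
  0 <= angle x < pi / 3 /\ symb (angle x) = x.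
Proof.
move=> /andP[x0 xL]; rewrite /angle.
set y := _ `^ _; set u := 1 / 3 * _; set z := _ * tanh u.
have Lx1 : 1 <= L R / x by rewrite ler_pdivlMr// mul1r.
have Lx0 : 0 <= L R / x by rewrite (le_trans _ Lx1).
have y2 : y ^+ 2 = (L R / x) ^+ 3.
  rewrite /y -powR_mulrn ?powR_ge0// -powRrM -powR_mulrn//.
  by congr (_ `^ _); field.
have y1 : 1 <= y.
  rewrite -(@ler_pXn2r _ 2) ?nnegrE ?powR_ge0// expr1n y2.
  exact: exprn_ege1.
have [a0 ya] := arcoshP y1.
have u0 : 0 <= u by rewrite mulr_ge0// divr_ge0.
have c0 := cosh_gt0 u; have ch2 := cosh2Bsinh2 u.
have yE : y = 4 * cosh u ^+ 3 - 3 * cosh u.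
  by rewrite -cosh_triple -ya; congr cosh; rewrite /u; field.
have sh0 : 0 <= sinh u.
  by rewrite divr_ge0// subr_ge0 ler_expR; lra.
have {}ch2 : sinh u ^+ 2 = cosh u ^+ 2 - 1 by rewrite -ch2; ring.
have c1 : 1 <= cosh u ^+ 2 by rewrite -subr_ge0 -ch2 sqr_ge0.
have z0 : 0 <= z by rewrite mulr_ge0 ?sqrtr_ge0// divr_ge0// ltW.
have z2 : z ^+ 2 = 3 * (cosh u ^+ 2 - 1) / cosh u ^+ 2.
  by rewrite /z exprMn sqr_sqrtr// /tanh expr_div_n ch2 mulrA.
have d0 : 0 < 4 * cosh u ^+ 2 - 3 by lra.
have ca0 : 0 < cos (atan z).
  by apply: cos_gt0_pihalf; rewrite atan_gtNpi2 atan_ltpi2.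
have ca2 : cos (atan z) ^+ 2 = cosh u ^+ 2 / (4 * cosh u ^+ 2 - 3).
  rewrite cos_atan exprVn sqr_sqrtr ?addr_ge0 ?sqr_ge0// z2.
  by field; rewrite !gt_eqF//; lra.
have ca_half : 1 / 2 < cos (atan z).
  rewrite -(@ltr_pXn2r _ 2) ?nnegrE ?ltW// ca2.
  by rewrite ltr_pdivlMr//; lra.
split; last first.
  have s0 : 0 < symb (atan z) ^+ 3.
    rewrite symbX3// divr_gt0 ?exprn_gt0 ?mulr_gt0 ?exprn_gt0//.
    by rewrite ca2 subr_gt0 mulrA ltr_pdivlMr//; lra.
  have {}s0 : 0 <= symb (atan z).
    by rewrite -(exprn_odd_ge0 _ (isT : odd 3)) ltW.
  apply/eqP; rewrite -(@eqrXn2 _ 3) ?(ltW x0)//.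
  rewrite symbX3// ca2; apply/eqP.
  have -> : x ^+ 3 = L R ^+ 3 / y ^+ 2.
    by rewrite y2; field; rewrite !gt_eqF ?L_gt0.
  rewrite LX3 yE; field.
  by rewrite -yE !gt_eqF// (lt_le_trans _ y1).
apply/andP; split; first by rewrite -(atan0 R) le_atan.
have pi0 := @pi_gt0 R; have a2 := atan_ltpi2 z.
rewrite ltNge; apply/negP => le3; move: ca_half.
by rewrite -cos_pi_third ltr_cos ?in_itv/=; lra.
Qed.

(** * Counting in finite sequences *)

Lemma count_chain {R : realType} (s : seq R) (P : pred R) (f : nat -> R)
    (a b : nat) :
  (forall k, (a <= k < b)%N ->
    exists l, [/\ l \in s, P l & f k.+1 < l < f k]) ->
  (b - a <= count P s)%N.
Proof.
(* Counting only members above [f b] strengthens the induction: the next one lies below [f b], so it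
   is new. *)
move=> fP; suff : (b - a <= count (fun l => P l && (f b < l)%R) s)%N.
  by move/leq_trans; apply; apply: sub_count => l /= /andP[].
elim: b fP => // b IH fP; have [ab|ba] := leqP a b; last first.
  by rewrite (eqP (_ : (b.+1 - a)%N == 0)).
have {}IH := IH _; rewrite subSn//.
have [|l [ls Pl /andP[lb1 lb]]] := fP b; first by rewrite ab leqnn.
pose A := (fun l => P l && (f b < l)).
have IHA : (b - a <= count A s)%N.
  by apply: IH => k /andP[ak kb]; apply: fP; rewrite ak ltnW.
have l1 : (0 < count (pred1 l) s)%N by rewrite -has_count has_pred1.
have := count_predUI A (pred1 l) s.
rewrite (@eq_count _ (predI A (pred1 l)) pred0) ?count_pred0 ?addn0; last first.
  by move=> z /=; case: eqP => [->|]; rewrite ?andbF// /A ltNge ltW// !andbF.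
move=> e; apply: (@leq_trans (count (predU A (pred1 l)) s)).
  by rewrite e -addn1 leq_add.
apply: sub_count => z /= /orP[/andP[-> fz]|/eqP ->]; last by rewrite Pl.
by rewrite (lt_trans _ fz)// (lt_trans lb1).
Qed.

(** Indices from [size s] on read the default 0, which is at most [x], so they belong to the set;
    the only indices outside it are those of entries above [x]. *)
Lemma card_nth_le {R : realType} (s : seq R) (m : nat) (x : R) :
  (size s <= m)%N -> 0 <= x ->
  (#|[set j : 'I_m | (nth 0 s j <= x)%R]%SET| + count (fun l => (x < l)%R) s = m)%N.
Proof.
move=> sm x0; rewrite -sum1_card.
rewrite (eq_bigl (fun j : 'I_m => nth 0 s j <= x)); last first.
  by move=> j; rewrite inE.
rewrite -(big_mkord (fun j => nth 0 s j <= x) (fun=> 1%N)).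
rewrite sum1_count -(count_map (nth 0 s) (fun l => l <= x)).
rewrite /index_iota subn0 -(subnKC sm) iotaD map_cat count_cat add0n.
rewrite map_nth_iota0// take_size.
rewrite (_ : count _ (map _ (iota (size s) _)) = (m - size s)%N); last first.
  rewrite count_map -[RHS](size_iota (size s)); apply/eqP.
  rewrite -all_count; apply/allP => j; rewrite mem_iota => /andP[sj _] /=.
  by rewrite nth_default.
rewrite -(count_predC (fun l => l <= x) s).
rewrite (@eq_count _ (fun l => x < l) (predC (fun l => l <= x))); last first.
  by move=> l /=; rewrite ltNge.
by rewrite addnAC.
Qed.

(** * Test points and the count of eigenvalues *)

Section TestPoints.
Context {R : realType}.

(* At these points [cos (n%:R * t) = 0], so [horner_dpoly_symb] gives the sign
   of [dpoly n]. *)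
Definition testpt (n k : nat) : R := (k%:R + 1 / 2) * pi / n%:R.

Lemma testpt_gt0 n k : (0 < n)%N -> 0 < testpt n k.
Proof.
by move=> n0; rewrite divr_gt0 ?ltr0n// mulr_gt0 ?pi_gt0// ltr_wpDl.
Qed.

Lemma testptS n k : (0 < n)%N -> testpt n k < testpt n k.+1.
Proof.
move=> n0; rewrite /testpt ltr_pM2r ?invr_gt0 ?ltr0n// ltr_pM2r ?pi_gt0//.
by rewrite ltrD2r ltr_nat.
Qed.

(** Consecutive test points give opposite signs, hence a root by the intermediate value theorem. It
    lies in []0, L[] because [symb] decreases from [L] to 0 on [[0, pi / 3]]. *)
Lemma eigs_between_testpts n k : testpt n.+2 k.+1 < pi / 3 ->
  exists2 l, l \in eigs R n &
    symb (testpt n.+2 k.+1) < l < symb (testpt n.+2 k).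
Proof.
move=> t3; have p0 j := @testpt_gt0 n.+2 j isT.
have tk := @testptS n.+2 k isT.
have nE j : n.+2%:R * testpt n.+2 j = (j%:R + 1 / 2) * pi.
  by rewrite /testpt mulrC divfK// pnatr_eq0.
have s1 : 0 < (-1) ^+ k.+1 * (dpoly n.+2).[symb (testpt n.+2 k.+1)].
  by apply: dpoly_sign; rewrite // p0.
have s0 : 0 < (-1) ^+ k * (dpoly n.+2).[symb (testpt n.+2 k)].
  by apply: dpoly_sign; rewrite // p0 (lt_trans tk).
have lt01 := symb_decr _ _ (ltW (p0 k)) tk (ltW t3).
(* The sign makes [p] pass from negative to positive for either parity of [k]. *)
pose p := (-1) ^+ k *: dpoly n.+2 : {poly R}.
have p1 : p.[symb (testpt n.+2 k.+1)] < 0.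
  by rewrite hornerZ -oppr_gt0 -mulNr -mulN1r -exprS.
have {}s0 : 0 < p.[symb (testpt n.+2 k)] by rewrite hornerZ.
have [|l] := @poly_ivt _ p _ _ (ltW lt01); first by rewrite !ltW.
rewrite !le_eqVlt => /andP[/predU1P[<-|l1]].
  by rewrite /root (lt_eqF p1).
move=> /predU1P[->|l0 pl]; first by rewrite /root (gt_eqF s0).
exists l; last by rewrite l1.
have dl : root (dpoly n.+2) l.
  by move: pl; rewrite /root hornerZ mulf_eq0 signr_eq0.
apply/mem_eigs; rewrite eigenvalue_dpoly; split=> //.
apply/andP; split.
  by rewrite (lt_trans _ l1)// -[ltLHS](@symb_pi_third R) symb_decr// ltW.
by rewrite (lt_trans l0)// -symb0 symb_decr// ltW// (lt_trans tk).
Qed.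

(** Each gap between test points below [t] holds an eigenvalue above [x], which makes at least K -
    1. Each gap between [t] and [pi / 3] holds one at most [x]. [size_eigs] bounds the total. *)
Lemma card_eigs_bounds (n : nat) (x t : R) :
  0 <= t <= pi / 3 -> symb t = x ->
  let K := Num.truncn (n.+2%:R * t / pi) in
  let c := #|[set j : 'I_(n %/ 3) | (lambda R n j <= x)%R]%SET| in
  (n %/ 3 <= c + K + 2)%N /\ (c + K <= n %/ 3 + 1)%N.
Proof.
move=> /andP[t0 t3] xE K c.
have pi0 := @pi_gt0 R.
have N0 : 0 < n.+2%:R :> R by rewrite ltr0n.
have x0 : 0 <= x.
  rewrite -xE -(@symb_pi_third R); move: t3; rewrite le_eqVlt => /predU1P[->//|].
  by move=> t3; rewrite ltW// symb_decr.
have /andP[Kle Klt] : K%:R <= n.+2%:R * t / pi < K.+1%:R.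
  by apply: truncn_itv; rewrite divr_ge0 ?mulr_ge0// ltW.
(* The test point of index [K] may lie on either side of [t], so only other indices are compared. *)
have ltt k : (k < K)%N -> testpt n.+2 k < t.
  move=> kK; rewrite /testpt ltr_pdivrMr// -ltr_pdivlMr// [t * _]mulrC.
  rewrite (lt_le_trans _ Kle)//.
  have : k.+1%:R <= K%:R :> R by rewrite ler_nat.
  by rewrite -natr1; lra.
have gtt k : (K < k)%N -> t < testpt n.+2 k.
  move=> kK; rewrite /testpt ltr_pdivlMr// -ltr_pdivrMr// [t * _]mulrC.
  rewrite (lt_trans Klt)//.
  have : K.+1%:R <= k%:R :> R by rewrite ler_nat.
  by lra.
have lt3 k : (k < n.+2 %/ 3)%N -> testpt n.+2 k < pi / 3.
  move=> kn; rewrite /testpt ltr_pdivrMr// -mulrA [ltRHS]mulrC ltr_pM2r//.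
  have : (k.+1 * 3)%:R <= n.+2%:R :> R by rewrite ler_nat -leq_divRL.
  by rewrite natrM -natr1; lra.
have cE : (c + count (fun l => (x < l)%R) (eigs R n) = n %/ 3)%N.
  by apply: card_nth_le => //; exact: size_eigs.
have up : (K.-1 - 0 <= count (fun l => (x < l)%R) (eigs R n))%N.
  apply: (@count_chain R _ _ (fun k => symb (testpt n.+2 k))) => k /= kK.
  have k1 : (k.+1 < K)%N by lia.
  have [|l le /andP[l1 l0]] := eigs_between_testpts n k.
    exact: lt_le_trans (ltt _ k1) t3.
  exists l; rewrite l1 l0; split=> //; apply: lt_trans l1.
  by rewrite -xE symb_decr// ?ltt// ltW// testpt_gt0.
have low : ((n.+2 %/ 3).-1 - K.+1 <=
    count (predC (fun l => (x < l)%R)) (eigs R n))%N.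
  apply: (@count_chain R _ _ (fun k => symb (testpt n.+2 k))) => k /= kK.
  have k1 : (k.+1 < n.+2 %/ 3)%N by lia.
  have [|l le /andP[l1 l0]] := eigs_between_testpts n k; first exact: lt3.
  exists l; rewrite l1 l0; split=> //; rewrite -leNgt ltW//.
  apply: lt_trans l0 _; rewrite -xE symb_decr//; last by rewrite ltW// lt3// ltnW.
  by case/andP: kK => /gtt.
move: (count_predC (fun l => (x < l)%R) (eigs R n)) (@size_eigs R n) cE up low.
have : (n %/ 3 <= n.+2 %/ 3)%N by rewrite leq_div2r// leqW.
move: (count _ _) (count (predC _) _) (size _) => u v w.
by clearbody c K; clear; lia.
Qed.

(** * Passage to the limit *)

Lemma cvg_H (x t : R) :
  0 <= t <= pi / 3 -> symb t = x -> H n x @[n --> \oo] --> 1 / 3 - t / pi.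
Proof.
move=> t3 xE; have pi0 := @pi_gt0 R.
have q3 : 0 <= t / pi <= 1 / 3.
  by rewrite ler_pdivlMr// ler_pdivrMr//; lra.
apply/cvgrPdist_le => e e0; near=> n.
have n0 : (0 < n)%N by near: n; exact: nbhs_infty_gt.
have ne : 4 / e <= n%:R by near: n; exact: nbhs_infty_ger.
have {n0} : 0 < n%:R :> R by rewrite ltr0n.
have [] := card_eigs_bounds n x t t3 xE.
have /andP[] : (Num.truncn (n.+2%:R * t / pi))%:R <= n.+2%:R * t / pi <
    (Num.truncn (n.+2%:R * t / pi)).+1%:R.
  by apply: truncn_itv; rewrite divr_ge0 ?mulr_ge0//; lra.
rewrite /H; set K := Num.truncn _; set c := #|_|.
have -> : n.+2%:R * t / pi = n%:R * (t / pi) + 2 * (t / pi).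
  by rewrite -!natr1; ring.
move: (t / pi) q3 => q q3; rewrite -natr1 => Kle Klt.
rewrite -!(ler_nat R) !natrD => cK1 cK2 n0.
have m3 : (n %/ 3 * 3)%:R <= n%:R :> R by rewrite ler_nat leq_divM.
have m3' : n%:R <= (n %/ 3 * 3 + 3)%:R :> R.
  by rewrite ler_nat {1}(divn_eq n 3) leq_add2l ltnW// ltn_mod.
rewrite natrD !natrM in m3 m3'.
have -> : 1 / 3 - q - c%:R / n%:R = (n%:R * (1 / 3 - q) - c%:R) / n%:R.
  by field; rewrite gt_eqF.
rewrite normrM normfV (gtr0_norm n0) ler_pdivrMr//.
apply: (@le_trans _ _ 4); last by rewrite mulrC -ler_pdivrMr.
(* From above, the error is at most 2 from [cK1], 1 from [n %/ 3] and 2 q <= 2/3 from the shift to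
   [n.+2]; from below it is at least -2. *)
rewrite ler_norml; nra.
Unshelve. all: by end_near. Qed.

End TestPoints.

Theorem theorem1p2 (R : realType) (x : R) (hx : 0 <= x <= L R) :
  H n x @[n --> \oo] --> F x.
Proof.
move: hx => /andP[x0 xL]; have pi0 := @pi_gt0 R.
rewrite /F; case: eqP => [->|/eqP xn0].
  (* The value [x = 0] corresponds to [t = pi / 3]. *)
  have e : 1 / 3 - pi / 3 / pi = 0 :> R.
    by rewrite [pi / 3]mulrC mulfK ?gt_eqF// div1r subrr.
  rewrite -[X in _ --> X]e; apply: cvg_H; last exact: symb_pi_third.
  by rewrite lexx andbT divr_ge0// ltW.
have [|/andP[a0 a3] aE] := angle_symb x; first by rewrite lt_neqAle eq_sym xn0 x0.
rewrite -/(angle x) [1 / pi * _]mulrAC [1 * angle x]mul1r; apply: cvg_H => //.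
by rewrite a0 ltW.
Qed.
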